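(* Let $\mathcal H$ be an irreducible reproducing kernel Hilbert space on a set $X$ with kernel $K$. Suppose that $K$ is normalized at $x_0 \in X$ and that $\mathcal H$ satisfies the two-point Nevanlinna-Pick property. Then $$\sup\{\operatorname{Re}\varphi(w): \|\varphi\|_{\operatorname{Mult}(\mathcal H)}\le 1 \text{ and } \varphi(x_0)=0\} = \Big(1-\frac{1}{K(w,w)}\Big)^{1/2}$$ for every $w\in X$, and this number is strictly positive if $w\ne x_0$. Moreover, if $w \neq x_0$, there is a unique multiplier $\varphi_w$ which achieves the supremum (among $\varphi\in\operatorname{Mult}(\mathcal H)$ with $\|\varphi\|_{\operatorname{Mult}(\mathcal H)}\le1$ and $\varphi(x_0)=0$), namely $$\varphi_w(z)=\frac{1-\frac{1}{K(z,w)}}{\sqrt{1-\frac{1}{K(w,w)}}}\quad(z\in X).$$ Equivalently, $$K(z,w)=\frac{1}{1-\varphi_w(z)\varphi_w(w)}\quad (z\in X).$$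
   Context: Reproducing kernel Hilbert spaces are separable complex Hilbert spaces of functions on a set. $\operatorname{Mult}(\mathcal H)$ is the algebra of all $\varphi : X \to \mathbb C$ with $\varphi f \in \mathcal H$ for all $f \in \mathcal H$, with norm $\|\varphi\|_{\operatorname{Mult}(\mathcal H)}=\|M_\varphi\|$, $M_\varphi f=\varphi f$. $\mathcal H$ is irreducible if $K(x,y)\ne0$ for all $x,y\in X$ and $K(\cdot,x),K(\cdot,y)$ are linearly independent for $x\ne y$. $K$ is normalized at $x_0$ if $K(x,x_0)=1$ for all $x\in X$. $\mathcal H$ satisfies the two-point Nevanlinna-Pick property if, whenever $z_1,z_2\in X$ and $\lambda_1,\lambda_2\in\mathbb C$ are such that the matrix $\big((1-\lambda_i\overline{\lambda_j})K(z_i,z_j)\big)_{i,j=1}^2$ is positive semidefinite, there exists $\varphi\in\operatorname{Mult}(\mathcal H)$ with $\|\varphi\|_{\operatorname{Mult}(\mathcal H)}\le1$ and $\varphi(z_i)=\lambda_i$ for $i=1,2$. *)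

(* Defs.v *)
From HB Require Import structures.
From mathcomp Require Import all_boot all_order all_algebra.
From mathcomp Require Import sesquilinear complex.
From mathcomp Require Import all_classical all_reals all_analysis.
Set Implicit Arguments.
Unset Strict Implicit.
Unset Printing Implicit Defensive.
Import Order.TTheory GRing.Theory Num.Theory.
Import numFieldNormedType.Exports.

Local Open Scope classical_set_scope.
Local Open Scope ring_scope.

(* The elements of [H] are presented as functions on [X] through the injective
   linear map [rkhs_fun]; the inner product is linear in its first argument. *)
Record rkhs (R : realType) (X : Type) := RKHS {
  rkhs_space :> completeNormedModType R[i];
  rkhs_dot : {dot rkhs_space for (@Num.conj R[i])};
  rkhs_normE : forall f : rkhs_space, `|f| ^+ 2 = rkhs_dot f f;
  rkhs_separable : exists D : set rkhs_space, countable D /\ dense D;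
  rkhs_fun : {linear rkhs_space -> (X -> R[i]^o)};
  rkhs_fun_inj : injective rkhs_fun;
  rkhs_fun_continuous : forall x : X,
    continuous (fun f : rkhs_space => rkhs_fun f x : R[i]^o)
}.

Section RKHSTheory.
Context (R : realType) (X : Type) (H : rkhs R X).
Implicit Types (K : X -> X -> R[i]) (phi : X -> R[i]).

Definition reproducing_kernel K : Prop :=
  forall y : X, exists k : H,
    (forall x, rkhs_fun H k x = K x y) /\
    (forall f : H, rkhs_fun H f y = rkhs_dot H f k).

Definition irreducible_kernel K : Prop :=
  (forall x y, K x y != 0) /\
  (forall x y, x <> y -> forall a b : R[i],
     (forall z, a * K z x + b * K z y = 0) -> a = 0 /\ b = 0).

Definition normalized_at K (x0 : X) : Prop := forall x, K x x0 = 1.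

Definition mult : set (X -> R[i]) :=
  [set phi | forall f : H, exists g : H,
     forall x, rkhs_fun H g x = phi x * rkhs_fun H f x].

(* The value is the function [phi f], and the default 0 occurs only when
   [phi f] is not in [H]. *)
Definition mult_op phi (f : H) : H :=
  xget 0 [set g : H | forall x, rkhs_fun H g x = phi x * rkhs_fun H f x].

(* Norms of elements of [H] are nonnegative reals inside [R[i]], hence [Re].
   The operator norm is taken in [\bar R], where the supremum of an unbounded
   set is [+oo]. *)
Definition mult_norm phi : \bar R :=
  ereal_sup [set (complex.Re `|mult_op phi f|)%:E
            | f in [set f : H | `|f| <= 1]].

Definition psdmx n (A : 'M[R[i]]_n) : Prop :=
  forall u : 'rV[R[i]]_n, 0 <= (u *m A *m (map_mx Num.conj u)^T) 0 0.

Definition two_point_NP K : Prop :=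
  forall (z : 'I_2 -> X) (lam : 'I_2 -> R[i]),
    psdmx (\matrix_(i < 2, j < 2)
             ((1 - lam i * Num.conj (lam j)) * K (z i) (z j))) ->
    exists phi, [/\ mult phi, (mult_norm phi <= 1)%E &
                    forall i, phi (z i) = lam i].

Definition vanishing_mult_ball (x0 : X) : set (X -> R[i]) :=
  [set phi | [/\ mult phi, (mult_norm phi <= 1)%E & phi x0 = 0]].

Definition vanishing_mult_sup (x0 w : X) : \bar R :=
  ereal_sup [set (complex.Re (phi w))%:E | phi in vanishing_mult_ball x0].

End RKHSTheory.

(* Main.v *)
Require Import Defs.
From HB Require Import structures.
From mathcomp Require Import all_boot all_order all_algebra.
From mathcomp Require Import sesquilinear complex.
From mathcomp Require Import all_classical all_reals all_analysis.
From mathcomp Require Import ring.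
Import Order.TTheory GRing.Theory Num.Theory.
Import numFieldNormedType.Exports.

Local Open Scope classical_set_scope.
Local Open Scope ring_scope.

(** A contractive multiplier [phi] vanishing at the base point [x0] sends the
kernel function [k] of [w] to some [g] with [|g| <= |k|], [g w = phi w * K w w]
and [g x0 = 0].  As point evaluations are inner products with kernel functions,
the inner product of [g] with the kernel function [k0] of [x0] is [0] and its
inner product with [k] is [phi w * K w w].  Writing [c = K w w] and
[r = Re (phi w)], expanding a square gives
[|r g - (k - k0)|^2 <= r^2 c + (c - 1) - 2 r^2 c = (c - 1) - c r^2]
([kernel_residual_le]).

Nonnegativity of the left-hand side is the upper bound [r^2 <= 1 - 1/c].  If
this bound is attained the left-hand side vanishes, so [r g = k - k0], that is
[r * phi z * K z w = K z w - 1] for all [z]: this equation determines [phi] and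
is the formula for the extremal function ([extremal_multiplier]).

The bound is attained because the two-point data [x0 |-> 0],
[w |-> sqrt (1 - 1/c)] have the all-ones Pick matrix, which is positive
semidefinite ([pick_extremal_multiplier]).  Finally [|k - k0|^2 = c - 1], so
[c > 1] as soon as [k] and [k0] differ, which irreducibility guarantees for
[w <> x0]. *)

Section Multipliers.
Context {R : realType} {X : Type} {H : rkhs R X}.
Implicit Types (phi : X -> R[i]) (f g k : H) (x y : X).

Lemma rkhs_funB f g x : rkhs_fun H (f - g) x = rkhs_fun H f x - rkhs_fun H g x.
Proof. by rewrite linearB. Qed.

Lemma rkhs_funZ (a : R[i]) f x : rkhs_fun H (a *: f) x = a * rkhs_fun H f x.
Proof. by rewrite linearZ. Qed.

Lemma rkhs_funP f g : (forall x, rkhs_fun H f x = rkhs_fun H g x) -> f = g.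
Proof. by move=> fg; apply: (@rkhs_fun_inj _ _ H); apply/funext. Qed.

Lemma mult_op_eq phi f g :
  (forall x, rkhs_fun H g x = phi x * rkhs_fun H f x) -> mult_op phi f = g.
Proof.
move=> gP; rewrite /mult_op; case: xgetP => [h _ hP|/(_ g)//].
by apply: rkhs_funP => x; rewrite hP gP.
Qed.

(** The operator norm is a supremum over the unit ball only, so the general
case is obtained by rescaling [f] to norm one. *)
Lemma mult_norm_le1 phi f g : (mult_norm H phi <= 1)%E ->
  (forall x, rkhs_fun H g x = phi x * rkhs_fun H f x) -> `|g| <= `|f|.
Proof.
move=> phi1 gP.
have [f0|f_neq0] := eqVneq f 0.
  suff -> : g = 0 by rewrite f0.
  by apply: rkhs_funP => x; rewrite gP f0 linear0 /= mulr0.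
have f_gt0 : 0 < `|f| by rewrite normr_gt0.
have scaleP x : rkhs_fun H (`|f|^-1 *: g) x
    = phi x * rkhs_fun H (`|f|^-1 *: f) x.
  by rewrite !rkhs_funZ gP mulrCA.
have : ((complex.Re `|mult_op phi (`|f|^-1 *: f)|)%:E <= 1)%E.
  apply: le_trans phi1; apply: ereal_sup_ubound; exists (`|f|^-1 *: f) => //=.
  by rewrite normrZ normfV normr_id mulVf ?gt_eqF.
rewrite (mult_op_eq _ _ _ scaleP) lee_fin -lecR.
rewrite RRe_real ?ger0_real // normrZ normfV normr_id.
by rewrite mulrC ler_pdivrMr // mul1r.
Qed.

Lemma psdmx_const1 n : psdmx (const_mx 1 : 'M[R[i]]_n).
Proof.
move=> u; set S := \sum_j u 0 j.
suff -> : (u *m const_mx 1 *m (map_mx Num.conj u)^T) 0 0 = S * Num.conj S.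
  exact: mul_conjC_ge0.
rewrite mxE rmorph_sum mulr_sumr; apply: eq_bigr => j _.
rewrite !mxE; congr (_ * _); apply: eq_bigr => i _.
by rewrite mxE mulr1.
Qed.

End Multipliers.

Section ExtremalMultiplier.
Context {R : realType} {X : Type} {H : rkhs R X}.
Context {K : X -> X -> R[i]} {x0 : X} (w : X).
Hypotheses (hK : reproducing_kernel H K) (hnorm : normalized_at K x0).
Implicit Types (phi : X -> R[i]) (f g k : H) (x y z : X).

Local Notation "''[' u , v ]" := (rkhs_dot H u v) : ring_scope.
Local Notation c := (complex.Re (K w w)).
Local Notation s := (Num.sqrt (1 - c^-1)).
Local Notation kernel_at y k :=
  ((forall x, rkhs_fun H k x = K x y) /\ (forall f, rkhs_fun H f y = '[f, k])).

Lemma kernel_norm k : kernel_at w k -> `|k| ^+ 2 = K w w.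
Proof. by case=> kE kr; rewrite rkhs_normE -kr kE. Qed.

Lemma kernel_diag_real : K w w = c%:C%C.
Proof.
have [k kP] := hK w.
by rewrite RRe_real // -(kernel_norm k kP) rpredX // ger0_real.
Qed.

Lemma kernel_base x : K x0 x = 1.
Proof.
have [k0 [k0E k0r]] := hK x0; have [k [kE kr]] := hK x.
rewrite -kE k0r hermC /= -kr k0E hnorm.
by rewrite expr0 mul1r rmorph1.
Qed.

Lemma norm_kernel_diff k k0 : kernel_at w k -> kernel_at x0 k0 ->
  `|k - k0| ^+ 2 = (c - 1)%:C%C.
Proof.
move=> kP [k0E k0r]; have [kE _] := kP.
rewrite rkhs_normE dnormB /= -!rkhs_normE (kernel_norm k kP).
rewrite rkhs_normE -!k0r k0E kE !kernel_base rmorph1 kernel_diag_real.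
rewrite rmorphB rmorph1 /=; ring.
Qed.

Lemma kernel_diag_ge1 : 1 <= c.
Proof.
have [k kP] := hK w; have [k0 k0P] := hK x0.
by rewrite -subr_ge0 -ler0c -(norm_kernel_diff k k0) // exprn_ge0.
Qed.

Lemma kernel_diag_gt0 : 0 < c.
Proof. exact: lt_le_trans ltr01 kernel_diag_ge1. Qed.

Lemma sqr_extremal_value : s ^+ 2 = 1 - c^-1.
Proof.
rewrite sqr_sqrtr // subr_ge0.
by rewrite invf_le1 ?kernel_diag_ge1 ?kernel_diag_gt0.
Qed.

(** If [c = 1] then [|k - k0|^2 = 0], so [K z w - K z x0 = 0] for all [z],
against linear independence. *)
Lemma extremal_value_gt0 : irreducible_kernel K -> w <> x0 -> 0 < s.
Proof.
move=> [_ indep] wx0; rewrite sqrtr_gt0 subr_gt0 invf_lt1 ?kernel_diag_gt0 //.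
rewrite lt_neqAle kernel_diag_ge1 andbT; apply/eqP => c1.
have [k kP] := hK w; have [k0 k0P] := hK x0.
have kk0 : k - k0 = 0.
  apply/eqP; rewrite -normr_eq0 -sqrf_eq0 (norm_kernel_diff k k0) //.
  by rewrite -c1 subrr.
suff [/eqP] : (1 : R[i]) = 0 /\ (-1 : R[i]) = 0 by rewrite oner_eq0.
apply: (indep w x0 wx0) => z.
by rewrite mul1r mulN1r -kP.1 -k0P.1 -rkhs_funB kk0 linear0.
Qed.

(** The coefficient [Re (phi w)] minimizes over real [r] the upper bound
[r^2 c + (c - 1) - 2 r c Re (phi w)] for [|r g - (k - k0)|^2]. *)
Lemma kernel_residual_le phi k k0 g :
  kernel_at w k -> kernel_at x0 k0 ->
  (mult_norm H phi <= 1)%E -> phi x0 = 0 ->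
  (forall x, rkhs_fun H g x = phi x * rkhs_fun H k x) ->
  `|(complex.Re (phi w))%:C%C *: g - (k - k0)| ^+ 2 <=
    (c - 1 - c * complex.Re (phi w) ^+ 2)%:C%C.
Proof.
move=> kP k0P phi1 phi0 gP; set r := complex.Re (phi w).
have [kE kr] := kP; have [_ k0r] := k0P.
have g_le : `|g| ^+ 2 <= c%:C%C.
  rewrite -kernel_diag_real -(kernel_norm k kP).
  by rewrite lerXn2r ?nnegrE // (mult_norm_le1 _ _ _ phi1 gP).
have dE : '[r%:C%C *: g, k - k0] = (r * c)%:C%C * phi w.
  rewrite linearZl_LR /= linearBr /= -kr -k0r !gP phi0 mul0r subr0.
  by rewrite kE kernel_diag_real rmorphM -mulrA (mulrC (phi w)).
rewrite rkhs_normE dnormB /= dE -!rkhs_normE (norm_kernel_diff k k0) //.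
rewrite normrZ exprMn.
have -> : `|r%:C%C| ^+ 2 = (r ^+ 2)%:C%C :> R[i].
  by rewrite -add_Re2_Im2 /= expr0n addr0.
rewrite addcJ.
have -> : complex.Re ((r * c)%:C%C * phi w) = r ^+ 2 * c.
  by rewrite /r; case: (phi w) => a b /=; rewrite mul0r subr0; ring.
have -> : (c - 1 - c * r ^+ 2)%:C%C =
    (r ^+ 2)%:C%C * c%:C%C + (c - 1)%:C%C - 2%:R * (r ^+ 2 * c)%:C%C :> R[i].
  by rewrite !(rmorphB, rmorphM) /=; ring.
by rewrite lerD2r lerD2r ler_wpM2l // ler0c sqr_ge0.
Qed.

Lemma Re_multiplier_le phi : vanishing_mult_ball H x0 phi ->
  complex.Re (phi w) <= s.
Proof.
move=> [phiM phi1 phi0].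
have [k kP] := hK w; have [k0 k0P] := hK x0; have [g gP] := phiM k.
apply: le_trans (ler_norm _) _.
rewrite -ler_sqr ?nnegrE ?sqrtr_ge0 // real_normK ?num_real //.
rewrite sqr_extremal_value.
have c_gt0 := kernel_diag_gt0.
rewrite -(ler_pM2l c_gt0) mulrBr mulr1 divff ?gt_eqF // -subr_ge0 -ler0c.
by rewrite (le_trans _ (kernel_residual_le phi k k0 g _ _ _ _ _)) ?exprn_ge0.
Qed.

(** The residual bound [c - 1 - c * s ^+ 2] vanishes, so [s g = k - k0] in [H];
evaluating at [z] gives [s * (phi z * K z w) = K z w - 1]. *)
Lemma extremal_multiplier phi z : irreducible_kernel K -> w <> x0 ->
  vanishing_mult_ball H x0 phi -> complex.Re (phi w) = s ->
  phi z = (1 - (K z w)^-1) / s%:C%C.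
Proof.
move=> hirr wx0 [phiM phi1 phi0] phis.
have [k kP] := hK w; have [k0 k0P] := hK x0; have [g gP] := phiM k.
have := kernel_residual_le phi k k0 g kP k0P phi1 phi0 gP.
have c_gt0 := kernel_diag_gt0.
rewrite phis sqr_extremal_value mulrBr mulr1 divff ?gt_eqF // subrr.
rewrite rmorph0 => res_le0.
have : `|s%:C%C *: g - (k - k0)| == 0.
  by rewrite -sqrf_eq0 eq_le res_le0 exprn_ge0.
rewrite normr_eq0 subr_eq0 => /eqP/(congr1 (fun f => rkhs_fun H f z)).
rewrite rkhs_funZ rkhs_funB gP kP.1 k0P.1 hnorm => E.
have s_neq0 : s%:C%C != 0 :> R[i].
  by rewrite (inj_eq (@complexI R) s 0) gt_eqF // extremal_value_gt0.
have Kzw := hirr.1 z w.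
have -> : phi z = s%:C%C * (phi z * K z w) / (s%:C%C * K z w).
  by field; rewrite s_neq0 Kzw.
by rewrite E; field; rewrite s_neq0 Kzw.
Qed.

(** The value [s] makes [(1 - s ^+ 2) * c = 1], which is the only entry of the
Pick matrix of [x0 |-> 0], [w |-> s] not already equal to [1] by normalization. *)
Lemma pick_extremal_multiplier : two_point_NP H K ->
  exists2 phi, vanishing_mult_ball H x0 phi & phi w = s%:C%C.
Proof.
move=> hNP.
pose z (i : 'I_2) := if i == 0 then x0 else w.
pose lam (i : 'I_2) : R[i] := if i == 0 then 0 else s%:C%C.
have [|phi [phiM phi1 phiP]] := hNP z lam; last first.
  exists phi; last exact: (phiP 1).
  by split => //; exact: (phiP 0).
suff -> : (\matrix_(i, j) ((1 - lam i * Num.conj (lam j)) * K (z i) (z j)))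
    = const_mx 1 by exact: psdmx_const1.
apply/matrixP => i j; rewrite !mxE /lam /z.
case: (i == 0); first by rewrite mul0r subr0 mul1r kernel_base.
case: (j == 0); first by rewrite rmorph0 mulr0 subr0 mul1r hnorm.
have -> : Num.conj (s%:C%C : R[i]) = s%:C%C by exact: conjc_real.
rewrite -expr2 -rmorphXn sqr_extremal_value -[1](rmorph1 (real_complex R)).
rewrite -rmorphB subKr kernel_diag_real -rmorphM /= mulVf //.
by rewrite gt_eqF ?kernel_diag_gt0.
Qed.

Lemma vanishing_mult_supE : two_point_NP H K -> vanishing_mult_sup H x0 w = s%:E.
Proof.
move=> hNP; apply/eqP; rewrite eq_le; apply/andP; split.
  by apply: ge_ereal_sup => _ [phi phiB <-]; rewrite lee_fin Re_multiplier_le.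
have [phi phiB phiw] := pick_extremal_multiplier hNP.
by apply: ereal_sup_ubound; exists phi => //; rewrite phiw.
Qed.

End ExtremalMultiplier.

Theorem proposition3p1 (R : realType) (X : Type) (H : rkhs R X)
    (K : X -> X -> R[i]) (x0 : X)
    (hK : reproducing_kernel H K)
    (hirr : irreducible_kernel K)
    (hnorm : normalized_at K x0)
    (hNP : two_point_NP H K) :
  forall w : X,
    let s := Num.sqrt (1 - (complex.Re (K w w))^-1) in
    vanishing_mult_sup H x0 w = s%:E /\
    (w <> x0 ->
       0 < s /\
       exists phi_w : X -> R[i],
         [/\ vanishing_mult_ball H x0 phi_w /\
               (complex.Re (phi_w w))%:E = vanishing_mult_sup H x0 w,
             forall psi : X -> R[i],
               vanishing_mult_ball H x0 psi ->
               (complex.Re (psi w))%:E = vanishing_mult_sup H x0 w ->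
               psi = phi_w,
             forall z, phi_w z = (1 - (K z w)^-1) / (s%:C)%C &
             forall z, K z w = (1 - phi_w z * phi_w w)^-1]).
Proof.
move=> w s.
have supE := vanishing_mult_supE w hK hnorm hNP.
split=> // wx0.
have s_gt0 : 0 < s := extremal_value_gt0 w hK hnorm hirr wx0.
have [phi phiB phiw] := pick_extremal_multiplier w hK hnorm hNP.
have formula psi z : vanishing_mult_ball H x0 psi ->
    complex.Re (psi w) = s -> psi z = (1 - (K z w)^-1) / s%:C%C.
  exact: (extremal_multiplier w hK hnorm psi z hirr wx0).
have phiE z := formula phi z phiB (congr1 (@complex.Re R) phiw).
split=> //; exists phi; split=> //.
- by rewrite supE phiw.
- move=> psi psiB; rewrite supE => -[psiw]; apply/funext => z.
  by rewrite phiE formula.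
- move=> z; rewrite phiE phiw divfK ?subKr ?invrK //.
  by rewrite (inj_eq (@complexI R) s 0) gt_eqF.
Qed.
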